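(* Let $k \ge 3$ be an integer, and let $f:\mathbb{N}\to\mathbb{C}$ be a multiplicative function such that \[ f(x_1^2 + x_2^2 + \dots + x_k^2) = f(x_1)^2 + f(x_2)^2 + \dots + f(x_k)^2 \] for all positive integers $x_1, x_2, \dots, x_k$. Then $f$ is the identity function, i.e. $f(n)=n$ for every positive integer $n$.
   Context: $\mathbb{N}$ denotes the set of positive integers. A function $f:\mathbb{N}\to\mathbb{C}$ is called multiplicative if $f(1)=1$ and $f(mn)=f(m)f(n)$ for all coprime positive integers $m$ and $n$. *)

(* Defs.v *)
From mathcomp Require Import all_boot all_order all_algebra.
From mathcomp Require Import complex reals.

Set Implicit Arguments.
Unset Strict Implicit.
Unset Printing Implicit Defensive.

Import GRing.Theory.
Local Open Scope ring_scope.

(* A function on the positive integers is a function on nat whose value at 0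
   is never used: all arguments below are required to be positive. *)
Definition arith_multiplicative (A : nzRingType) (f : nat -> A) : Prop :=
  f 1%N = 1 /\
  forall m n : nat, (0 < m)%N -> (0 < n)%N -> coprime m n ->
    f (m * n)%N = f m * f n.

(* Main.v *)
Require Import Defs.
From mathcomp Require Import all_boot all_order all_algebra.
From mathcomp Require Import complex reals.
From mathcomp Require Import zify ring.

Set Implicit Arguments.
Unset Strict Implicit.
Unset Printing Implicit Defensive.

Import GRing.Theory.
Local Open Scope ring_scope.
Local Open Scope complex_scope.

(** Put g(n) = f(n)^2.  Padding with ones, g(a) + g(b) + g(c) depends only on
    a^2 + b^2 + c^2.  Together with
    (2x+y)^2 + (x-2y)^2 = (2x-y)^2 + (x+2y)^2 for y = 1, 2 and a few
    small instances, this shows that g(n) = 1 + d (n^2 - 1) as soon as g(1) = 1,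
    g(2) = 1 + 3d and g(3) = 1 + 8d.  If k = 3 then f(3) = 3 and g(6) = g(2) g(3)
    give d = 1; if k >= 4 the relation 5^2 + 3 * 1^2 = 4^2 + 3 * 2^2 gives
    g(2) and g(3) in the required form, and f(k) = k forces d = 1.  So
    f(n) = n whenever n is a sum of k positive squares.

    If n is a sum of at most k positive squares, pick t coprime to n such that
    t^2 is a sum of r positive squares for each r <= k (a power of a Pythagorean
    hypotenuse works): then t^2 and t^2 n are
    sums of k positive squares, so f(n) = n.  In particular this holds for sums
    of at most three squares.  Strong induction reduces the rest to odd powers
    p s^2 of an odd prime p (s a power of p): some 0 < m < p satisfies
    p m = x^2 + y^2 + 1, whence f(p s^2 m) = p s^2 m, while f(m) = m by
    induction. *)

(** * Two squares plus one modulo an odd prime *)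

(** Pigeonhole: the residues of a^2 and of -1 - b^2 for 0 <= a, b <= (p-1)/2 are p + 1 values in p
    classes, and neither family repeats a value, so the two meet. *)
Lemma sum_two_squares_plus_one_dvd (p : nat) : prime p -> odd p ->
  exists m x y : nat, [/\ (0 < m)%N, (m < p)%N & (p * m = x ^ 2 + y ^ 2 + 1)%N].
Proof.
move=> pp op; have p_gt1 := prime_gt1 pp.
pose h := p./2.
have ph : p = (h.*2.+1)%N by rewrite -[LHS]odd_double_half op.
have p0 : (0 < p)%N by lia.
have sq_inj (a b : 'I_h.+1) : (a ^ 2 = b ^ 2 %[mod p])%N -> a = b.
  wlog le_ba : a b / (b <= a)%N.
    by move=> W E; case/orP: (leq_total a b) => ?; [symmetry|]; apply: W.
  move=> /eqP; rewrite eqn_mod_dvd ?leq_sqr // subn_sqr Euclid_dvdM //.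
  have := ltn_ord a; have := ltn_ord b => hb ha.
  case/orP=> /dvdnP [q Eq]; apply: val_inj => /=; case: q Eq => [|q]; nia.
(* The second branch is -1 - b^2 modulo p; [b ^ 2 %% p] is at most [p.-1], so the subtraction does
   not truncate. *)
pose F (z : 'I_h.+1 + 'I_h.+1) : 'I_p := match z with
  | inl a => Ordinal (ltn_pmod (a ^ 2) p0)
  | inr b => Ordinal (ltn_pmod (p.-1 - (b ^ 2 %% p)) p0) end.
have [injF|] := boolP (injectiveb F).
  have /injectiveP/leq_card := injF.
  by rewrite card_sum !card_ord; lia.
move=> /injectivePn [u [v neq_uv eqF]].
suff [a [b D]] : exists a b : 'I_h.+1, (p %| a ^ 2 + b ^ 2 + 1)%N.
  have [m Em] := dvdnP D; exists m, a, b.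
  have := ltn_ord a; have := ltn_ord b => hb ha.
  by split; nia.
have cross (a b : 'I_h.+1) : F (inl a) = F (inr b) ->
    (p %| a ^ 2 + b ^ 2 + 1)%N.
  move=> /(congr1 val) /=.
  have := ltn_pmod (b ^ 2) p0.
  have := divn_eq (a ^ 2) p; have := divn_eq (b ^ 2) p.
  move: (a ^ 2 %/ p)%N (b ^ 2 %/ p)%N => q q' Eb Ea lt.
  rewrite [RHS]modn_small; last by lia.
  by move=> E; apply/dvdnP; exists (q + q' + 1)%N; rewrite Ea Eb E; nia.
case: u v neq_uv eqF => [a|a] [b|b] neq eqF.
- by move: neq; rewrite (sq_inj a b) ?eqxx //; move/(congr1 val): eqF.
- by exists a, b; apply: cross.
- by exists b, a; apply: cross.
- move/(congr1 val): eqF => /= E; move: neq; rewrite (sq_inj a b) ?eqxx //.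
  have ha := ltn_pmod (a ^ 2) p0; have hb := ltn_pmod (b ^ 2) p0.
  by move: E; rewrite [LHS]modn_small ?[RHS]modn_small; lia.
Qed.

(** * Sums of a prescribed number of positive squares *)

Definition sumsq (s : seq nat) : nat := (\sum_(x <- s) x ^ 2)%N.

Definition is_sum_pos_sq (r N : nat) : Prop :=
  exists s : seq nat, [/\ size s = r, all (leq 1) s & sumsq s = N].

Lemma sumsq_cons (a : nat) (s : seq nat) : sumsq (a :: s) = (a ^ 2 + sumsq s)%N.
Proof. by rewrite /sumsq big_cons. Qed.

Lemma sumsq_cat (s t : seq nat) : sumsq (s ++ t) = (sumsq s + sumsq t)%N.
Proof. by rewrite /sumsq big_cat. Qed.

Lemma is_sum_pos_sq1 (a : nat) : (0 < a)%N -> is_sum_pos_sq 1 (a ^ 2).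
Proof. by exists [:: a]; rewrite /= /sumsq big_seq1; split=> //=; rewrite andbT. Qed.

Lemma is_sum_pos_sqD (r r' N N' : nat) :
  is_sum_pos_sq r N -> is_sum_pos_sq r' N' -> is_sum_pos_sq (r + r') (N + N').
Proof.
move=> [s [<- ps <-]] [s' [<- ps' <-]]; exists (s ++ s').
by rewrite size_cat all_cat ps ps' sumsq_cat.
Qed.

Lemma is_sum_pos_sqM (c r N : nat) : (0 < c)%N ->
  is_sum_pos_sq r N -> is_sum_pos_sq r (c ^ 2 * N).
Proof.
move=> c0 [s [<- ps <-]]; exists (map (muln c) s); split.
- by rewrite size_map.
- rewrite all_map; apply: sub_all ps => x /= x0.
  by rewrite muln_gt0 c0.
- rewrite /sumsq big_map big_distrr /=; apply: eq_bigr => x _.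
  by rewrite expnMn.
Qed.

(** Induction on [e]: c^(2e+2) = (u c^e)^2 + v^2 c^(2e), where the first term is one square and the
    second is cut into the other r - 1. *)
Lemma pythagorean_power_split (c u v : nat) : (0 < c)%N -> (0 < u)%N ->
  (0 < v)%N -> (c ^ 2 = u ^ 2 + v ^ 2)%N ->
  forall e r : nat, (0 < r <= e.+1)%N -> is_sum_pos_sq r ((c ^ e) ^ 2).
Proof.
move=> c0 u0 v0 E; elim=> [|e IH] [|[|r]] // hr.
- exact: is_sum_pos_sq1.
- by apply: is_sum_pos_sq1; rewrite expn_gt0 c0.
rewrite (expnS c) expnMn E mulnDl -expnMn -add1n; apply: is_sum_pos_sqD.
  by apply: is_sum_pos_sq1; rewrite muln_gt0 u0 expn_gt0 c0.
by apply: is_sum_pos_sqM => //; apply: IH.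
Qed.

Lemma exists_coprime_square_splits (k N : nat) : (0 < N)%N ->
  exists t : nat, [/\ (0 < t)%N, coprime t N &
    forall r : nat, (0 < r <= k)%N -> is_sum_pos_sq r (t ^ 2)].
Proof.
(* The base is 1 modulo N and is the hypotenuse of the triple with legs 4N^2 - 1 and 4N. *)
move=> N0; exists ((4 * N ^ 2 + 1) ^ k)%N; split.
- by rewrite expn_gt0 addn1.
- apply: coprimeXl.
  by rewrite /coprime gcdnC (_ : 4 * N ^ 2 = (4 * N) * N)%N ?gcdnMDl ?gcdn1 //; lia.
move=> r hr.
apply: (@pythagorean_power_split _ (4 * N ^ 2 - 1) (4 * N)); lia.
Qed.

(** * Multiplicative functions fixed on sums of squares *)

Section MultiplicativeOnSumsOfSquares.

Variables (A : numFieldType) (f : nat -> A).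
Hypothesis hmul : arith_multiplicative f.

Lemma eq_natr_of_coprime_mul (m n : nat) : (0 < m)%N -> (0 < n)%N ->
  coprime m n -> f m = m%:R -> f (m * n)%N = (m * n)%:R -> f n = n%:R.
Proof.
move=> m0 n0 co fm; rewrite hmul.2 // fm natrM; apply: mulfI.
by rewrite Num.Theory.pnatr_eq0 -lt0n.
Qed.

Lemma eq_natr_at_most_k_squares (k : nat) :
  (forall N, is_sum_pos_sq k N -> f N = N%:R) ->
  forall j N, (0 < j <= k)%N -> is_sum_pos_sq j N -> f N = N%:R.
Proof.
move=> hk [|j] // N hj [[|a s] []] //= [sz] /andP[a0 ps] EN.
have N0 : (0 < N)%N by rewrite -EN sumsq_cons addn_gt0 expn_gt0 a0.
have [t [t0 co split_t]] := exists_coprime_square_splits k N0.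
apply: (@eq_natr_of_coprime_mul (t ^ 2)) => //.
- by rewrite expn_gt0 t0.
- exact: coprimeXl.
- by apply: hk; apply: split_t; lia.
(* The entry [a] absorbs the padding: t^2 a^2 is cut into k - j squares, while the [j] entries of
   [s] are only scaled by [t]. *)
apply: hk; rewrite -EN sumsq_cons mulnDr (_ : k = (k - j) + j)%N; last lia.
apply: is_sum_pos_sqD.
  by rewrite mulnC; apply: is_sum_pos_sqM => //; apply: split_t; lia.
by apply: is_sum_pos_sqM => //; exists s.
Qed.

(** Since [b] and [c] may vanish, the hypothesis covers squares (even prime powers) and twice
    squares (odd powers of 2). *)
Lemma eq_natr_of_three_squares :
  (forall a b c : nat, (0 < a)%N ->
     f (a ^ 2 + b ^ 2 + c ^ 2)%N = (a ^ 2 + b ^ 2 + c ^ 2)%:R) ->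
  forall n : nat, (0 < n)%N -> f n = n%:R.
Proof.
move=> h3; elim/ltn_ind=> n IH n0.
have [->|n_neq1] := eqVneq n 1%N; first exact: hmul.1.
have n1 : (1 < n)%N by lia.
have pp := pdiv_prime n1; set p := pdiv n in pp.
have [m co En] := pfactor_coprime pp n0.
set e := logn p n in En.
have e0 : (0 < e)%N by rewrite logn_gt0 mem_primes pp n0 pdiv_dvd.
have pe_gt1 : (1 < p ^ e)%N by rewrite -(exp1n e) ltn_exp2r // prime_gt1.
have [m1|m_neq1] := eqVneq m 1%N; last first.
  have m_gt1 : (1 < m)%N by nia.
  rewrite En hmul.2 ?natrM; [|lia|lia|by rewrite coprime_sym coprimeXl].
  by rewrite !IH //; nia.
have {m m1 co} {}En : n = (p ^ e)%N by rewrite En m1 mul1n.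
pose s := (p ^ e./2)%N.
have s0 : (0 < s)%N by rewrite expn_gt0 prime_gt0.
have Es : (p ^ e = p ^ odd e * s ^ 2)%N.
  by rewrite -expnM -expnD muln2 odd_double_half.
case oe: (odd e) Es; rewrite ?expn1 ?expn0 ?mul1n => Es; last first.
  by have := h3 s 0%N 0%N s0; rewrite !addn0 -Es -En.
case op: (odd p); last first.
  have p2 : p = 2%N by case: (even_prime pp) => // op'; rewrite op' in op.
  have := h3 s s 0%N s0; rewrite addn0 addnn -mul2n.
  by rewrite -{1 3}p2 -Es -En.
have [m [x [y [m0 ltmp Em]]]] := sum_two_squares_plus_one_dvd pp op.
have le_pn : (p <= n)%N by rewrite En -{1}(expn1 p) leq_exp2l ?prime_gt1.
apply: (@eq_natr_of_coprime_mul m) => //.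
- rewrite En coprimeXr // coprime_sym prime_coprime //.
  by apply/negP => /(dvdn_leq m0); lia.
- by apply: IH => //; lia.
have -> : (m * n = s ^ 2 + (s * x) ^ 2 + (s * y) ^ 2)%N.
  by rewrite En Es mulnA (mulnC m) Em; lia.
exact: h3.
Qed.

End MultiplicativeOnSumsOfSquares.

(** * Functions compatible with three-square relations *)

Section QuadraticFunctions.

Variables (A : numFieldType) (g : nat -> A).
Hypothesis h3 : forall a b c a' b' c' : nat,
  [&& 0 < a, 0 < b, 0 < c, 0 < a', 0 < b' & 0 < c']%N ->
  (a ^ 2 + b ^ 2 + c ^ 2 = a' ^ 2 + b' ^ 2 + c' ^ 2)%N ->
  g a + g b + g c = g a' + g b' + g c'.

Lemma two_squares_relation (a b a' b' : nat) :
  [&& 0 < a, 0 < b, 0 < a' & 0 < b']%N ->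
  (a ^ 2 + b ^ 2 = a' ^ 2 + b' ^ 2)%N -> g a = g a' + g b' - g b.
Proof.
move=> /and4P[a0 b0 a'0 b'0] E.
have := @h3 a b 1 a' b' 1; rewrite a0 b0 a'0 b'0 E => /(_ isT erefl).
by move/addIr <-; rewrite addrK.
Qed.

Lemma three_squares_relation (a b c a' b' c' : nat) :
  [&& 0 < a, 0 < b, 0 < c, 0 < a', 0 < b' & 0 < c']%N ->
  (a ^ 2 + b ^ 2 + c ^ 2 = a' ^ 2 + b' ^ 2 + c' ^ 2)%N ->
  g a = g a' + g b' + g c' - g b - g c.
Proof. by move=> H E; rewrite -(h3 H E); ring. Qed.

Lemma double_value_at_4 : g 4 *+ 2 = g 5 + g 2 *+ 2 - g 1.
Proof.
have := @three_squares_relation 5 2 2 4 4 1 isT erefl => ->.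
by ring.
Qed.

Lemma quadratic_of_small_values (d : A) :
  g 1 = 1 -> g 2 = 1 + 3 * d -> g 3 = 1 + 8 * d ->
  forall n : nat, (0 < n)%N -> g n = 1 + d * (n%:R ^+ 2 - 1).
Proof.
move=> g1 g2 g3.
have g5 : g 5 = 1 + 24 * d.
  by rewrite (@three_squares_relation 5 1 1 3 3 3) // g1 g3; ring.
have g4 : g 4 = 1 + 15 * d.
  have nz : 2 != 0 :> A by rewrite Num.Theory.pnatr_eq0.
  apply: (mulIf nz); rewrite mulr_natr double_value_at_4 g5 g2 g1; ring.
have g6 : g 6 = 1 + 35 * d.
  by rewrite (@three_squares_relation 6 1 1 5 3 2) // g5 g3 g2 g1; ring.
have g7 : g 7 = 1 + 48 * d.
  by rewrite (@two_squares_relation 7 1 5 5) // g5 g1; ring.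
have g8 : g 8 = 1 + 63 * d.
  by rewrite (@two_squares_relation 8 1 7 4) // g7 g4 g1; ring.
have g10 : g 10 = 1 + 99 * d.
  by rewrite (@three_squares_relation 10 1 1 7 7 2) // g7 g2 g1; ring.
elim/ltn_ind=> n IH n0.
case on: (odd n).
  have [n_small|n_big] := ltnP n 7.
    move: n n_small n0 on {IH} => [|[|[|[|[|[|[|]]]]]]] // _ _ _.
    - by rewrite g1; ring.
    - by rewrite g3; ring.
    - by rewrite g5; ring.
  (* The identity with y = 1 at x + 3: the shift keeps all terms positive, and the other three lie
     below [n]. *)
  have [x En] : exists x, n = (2 * x + 7)%N by exists (n - 7)./2; lia.
  rewrite (@two_squares_relation n x.+1 (2 * x + 5) (x + 5)); try lia.
  rewrite !IH; try lia.
  by rewrite En; ring.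
have [n_small|n_big] := ltnP n 12.
  move: n n_small n0 on {IH} => [|[|[|[|[|[|[|[|[|[|[|[|]]]]]]]]]]]] // _ _ _.
  - by rewrite g2; ring.
  - by rewrite g4; ring.
  - by rewrite g6; ring.
  - by rewrite g8; ring.
  - by rewrite g10; ring.
(* The same identity with y = 2, at x + 5. *)
have [x En] : exists x, n = (2 * x + 12)%N by exists (n - 12)./2; lia.
rewrite (@two_squares_relation n x.+1 (2 * x + 8) (x + 9)); try lia.
rewrite !IH; try lia.
by rewrite En; ring.
Qed.

End QuadraticFunctions.

(** * The functional equation determines the squares of the values *)

Section SquaresOfValues.

Variables (A : numFieldType) (k : nat) (f : nat -> A).
Hypothesis hk : (3 <= k)%N.
Hypothesis hmul : arith_multiplicative f.
Hypothesis hsq : forall x : 'I_k -> nat, (forall i, (0 < x i)%N) ->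
  f (\sum_(i < k) x i ^ 2)%N = \sum_(i < k) f (x i) ^+ 2.

Lemma sum_squares_seq (s : seq nat) : size s = k -> all (leq 1) s ->
  f (sumsq s) = \sum_(x <- s) f x ^+ 2.
Proof.
move=> sz ps; rewrite /sumsq (big_nth 1%N) [RHS](big_nth 1%N) !big_mkord sz hsq // => i.
by apply: (all_nthP 1%N ps); rewrite sz.
Qed.

Lemma sum_squares_padded (s s' : seq nat) :
  size s = size s' -> (size s <= k)%N -> all (leq 1) s -> all (leq 1) s' ->
  sumsq s = sumsq s' -> \sum_(x <- s) f x ^+ 2 = \sum_(x <- s') f x ^+ 2.
Proof.
move=> ss' sk ps ps' E; pose o := nseq (k - size s) 1%N.
have po : all (leq 1) o by rewrite all_nseq orbT.
apply: (@addIr _ (\sum_(x <- o) f x ^+ 2)); rewrite -!big_cat /=.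
rewrite -!sum_squares_seq ?all_cat ?ps ?ps' ?po ?size_cat ?size_nseq ?sumsq_cat ?E //.
  by rewrite -ss' subnKC.
by rewrite subnKC.
Qed.

Lemma value_at_k : f k = k%:R.
Proof.
have := @sum_squares_seq (nseq k 1%N); rewrite size_nseq all_nseq orbT.
move=> /(_ erefl isT); rewrite /sumsq !big_nseq /= !iter_addn_0.
by rewrite hmul.1 expr1n exp1n mul1n iter_addr_0.
Qed.

Lemma square_values (n : nat) : (0 < n)%N -> f n ^+ 2 = n%:R ^+ 2.
Proof.
pose g n := f n ^+ 2.
have h3 a b c a' b' c' :
    [&& 0 < a, 0 < b, 0 < c, 0 < a', 0 < b' & 0 < c']%N ->
    (a ^ 2 + b ^ 2 + c ^ 2 = a' ^ 2 + b' ^ 2 + c' ^ 2)%N ->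
    g a + g b + g c = g a' + g b' + g c'.
  move=> /and5P[a0 b0 c0 a'0 /andP[b'0 c'0]] E.
  have := @sum_squares_padded [:: a; b; c] [:: a'; b'; c'] erefl hk.
  rewrite /= a0 b0 c0 a'0 b'0 c'0 /sumsq !unlock /= !addn0 !addr0 !addnA !addrA.
  exact.
have g1 : g 1%N = 1 by rewrite /g hmul.1 expr1n.
have nz8 : 8 != 0 :> A by rewrite Num.Theory.pnatr_eq0.
have g5 : g 5 = 3 * g 3 - 2.
  by rewrite (@three_squares_relation _ _ h3 5 1 1 3 3 3) // g1; ring.
suff [d [g2 g3 d1]] : exists d, [/\ g 2 = 1 + 3 * d, g 3 = 1 + 8 * d & d = 1].
  move=> n0; rewrite -/(g n) (quadratic_of_small_values h3 g1 g2 g3) // d1.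
  by ring.
move: hk; rewrite leq_eqVlt => /predU1P[k3|k4].
  have f3 : f 3 = 3 by move: value_at_k; rewrite -k3.
  exists 1; have g3 : g 3 = 9 by rewrite /g f3; ring.
  split=> //; last by rewrite g3; ring.
  (* With g(3) = 9 and g(5) = 25 this reads 9 g(2) + 2 = 25 + 9 + g(2), so g(2) = 4. *)
  have g6 := @three_squares_relation _ _ h3 6 1 1 5 3 2 isT erefl.
  have g23 : g 6 = g 2 * g 3 by rewrite /g -exprMn -hmul.2.
  apply: (mulfI nz8); move: g6; rewrite g23 g5 g3 g1 => E.
  have -> : 8 * g 2 = g 2 * 9 - g 2 by ring.
  by rewrite E; ring.
pose d := (g 3 - 1) / 8; exists d.
have g3 : g 3 = 1 + 8 * d by rewrite /d; field.
have g2 : g 2 = 1 + 3 * d.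
  (* Eliminating g(4) between this relation and [double_value_at_4] leaves 8 g(2) = g(5) + 7 = 8 +
     24 d. *)
  have := @sum_squares_padded [:: 5; 1; 1; 1]%N [:: 4; 2; 2; 2]%N erefl k4 isT isT.
  rewrite /sumsq !unlock => /(_ erefl) /=; rewrite -!/(g _) addr0 => E4.
  have E := double_value_at_4 h3.
  have {}E4 : g 4 = g 5 + 3 - 3 * g 2.
    have -> : g 5 + 3 = g 5 + (g 1 + (g 1 + g 1)) by rewrite g1; ring.
    by rewrite E4; ring.
  apply: (mulfI nz8); rewrite (_ : 8 * g 2 = (g 5 + g 2 *+ 2 - g 1)
    - (g 5 + 3 - 3 * g 2) *+ 2 + g 5 + 7); last by rewrite g1; ring.
  by rewrite -E -E4 g5 g3; ring.
split=> //.
have := quadratic_of_small_values h3 g1 g2 g3 (ltnW (ltnW hk)).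
rewrite /g value_at_k => E.
have nz : k%:R ^+ 2 - 1 != 0 :> A.
  rewrite subr_sqr_1 mulf_neq0 //.
    by rewrite subr_eq0 Num.Theory.pnatr_eq1; lia.
  by rewrite natr1 Num.Theory.pnatr_eq0.
by apply: (mulIf nz); rewrite mul1r {2}E; ring.
Qed.

(** At such [N] the equation involves only the squares f(x)^2, so the undetermined signs of the f(x)
    do no harm. *)
Lemma eq_natr_sum_of_k_squares (N : nat) : is_sum_pos_sq k N -> f N = N%:R.
Proof.
move=> [s [sz ps <-]]; rewrite sum_squares_seq // /sumsq natr_sum.
apply: eq_big_seq => x /(allP ps) x0.
by rewrite square_values // natrX.
Qed.

End SquaresOfValues.

Theorem mainTheorem1 (R : realType) (k : nat) (hk : (3 <= k)%N)
  (f : nat -> R[i]) (hmul : arith_multiplicative f)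
  (hsq : forall x : 'I_k -> nat, (forall i, (0 < x i)%N) ->
     f (\sum_(i < k) x i ^ 2)%N = \sum_(i < k) f (x i) ^+ 2) :
  forall n : nat, (0 < n)%N -> f n = n%:R.
Proof.
apply: (eq_natr_of_three_squares hmul) => a b c a0.
(* Dropping zeros leaves between one and three positive entries, hence at most [k]. *)
pose s := [seq x <- [:: a; b; c] | (0 < x)%N].
apply: (eq_natr_at_most_k_squares hmul
          (eq_natr_sum_of_k_squares hk hmul hsq) (j := size s)).
  rewrite size_filter /= a0 /=; lia.
exists s; split=> //; first exact: filter_all.
rewrite /sumsq big_filter !big_cons big_nil a0.
by case: b c {s} => [|b] [|c]; rewrite /= ?addn0 ?addnA.
Qed.
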